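(* Let $a<b$. Assume that $f:[a,b]\to\mathbb{R}$ is an absolutely $\beta$-integrable function on $[a,b]$. If $a\le s_0\le b$, then $$T_\beta(f,f)\ge 0 .$$
   Context: Setting: $I\subseteq\mathbb{R}$ is an interval, $a,b\in I$, and $\beta:I\to I$ is a strictly increasing continuous function with exactly one fixed point $s_0\in I$, satisfying $(t-s_0)(\beta(t)-t)\le 0$ for all $t\in I$, with equality only if $t=s_0$. Write $\beta^0(t)=t$ and $\beta^k$ for the $k$-fold composition of $\beta$ with itself. The $\beta$-integral is $\int_a^b h\,d_\beta:=\int_{s_0}^b h\,d_\beta-\int_{s_0}^a h\,d_\beta$, where $\int_{s_0}^x h\,d_\beta:=\sum_{k=0}^{\infty}\big(\beta^k(x)-\beta^{k+1}(x)\big)h\big(\beta^k(x)\big)$; also written $\int_a^b h(x)\,d_\beta x$. The function $h$ is $\beta$-integrable on $[a,b]$ if these series converge for $x=a$ and $x=b$, and absolutely $\beta$-integrable on $[a,b]$ if $|h|$ is $\beta$-integrable on $[a,b]$. For two absolutely $\beta$-integrable functions $f,g:[a,b]\to\mathbb{R}$ on $[a,b]$, the Chebyshev functional is $$T_\beta(f,g):=\frac{1}{b-a}\int_a^b f(x)g(x)\,d_\beta x-\left(\frac{1}{b-a}\int_a^b f(x)\,d_\beta x\right)\left(\frac{1}{b-a}\int_a^b g(x)\,d_\beta x\right).$$ *)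

(* Defs.v *)
From HB Require Import structures.
From mathcomp Require Import all_boot all_order all_algebra.
From mathcomp Require Import all_classical all_reals all_analysis.
Import Order.TTheory GRing.Theory Num.Theory.
Import numFieldNormedType.Exports.

Set Implicit Arguments.
Unset Strict Implicit.
Unset Printing Implicit Defensive.

Local Open Scope classical_set_scope.
Local Open Scope ring_scope.

(* A function on a subset of R is represented by a total function R -> R; every
   condition is relativized to the subset, so values outside it are irrelevant. *)
Record is_beta (R : realType) (I : interval R) (beta : R -> R) (s0 : R) : Prop :=
  IsBeta {
    beta_maps : {homo beta : t / t \in I};
    beta_incr : {in I &, {homo beta : t u / t < u}};
    beta_cont : {within [set` I], continuous beta};
    beta_s0_in : s0 \in I;
    beta_s0_fix : beta s0 = s0;
    beta_fix_uniq : {in I, forall t, beta t = t -> t = s0};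
    beta_attr : {in I, forall t, (t - s0) * (beta t - t) <= 0};
    beta_attr_eq : {in I, forall t, (t - s0) * (beta t - t) = 0 -> t = s0}
  }.

Definition beta_term (R : realType) (beta h : R -> R) (x : R) : R^nat :=
  fun k => (iter k beta x - iter k.+1 beta x) * h (iter k beta x).

Definition beta_integrable (R : realType) (beta : R -> R) (a b : R)
    (h : R -> R) : Prop :=
  cvgn (series (beta_term beta h a)) /\ cvgn (series (beta_term beta h b)).

Definition abs_beta_integrable (R : realType) (beta : R -> R) (a b : R)
    (h : R -> R) : Prop :=
  beta_integrable beta a b (fun x => `|h x|).

(* The integral is valued in the extended reals: absolute integrability of f
   does not imply integrability of f ^+ 2.  For integrable h the value is the
   usual real number, see [beta_integral_fin].  For h >= 0 and a <= s0 <= b, the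
   terms at b are nonnegative and those at a nonpositive, so both series have
   an extended limit and their difference is never of the form oo - oo.  The integral from s0 to x does not mention s0, since
   its defining series depends only on beta and x. *)
Definition beta_integral0 (R : realType) (beta h : R -> R) (x : R) : \bar R :=
  (\sum_(0 <= k <oo) (beta_term beta h x k)%:E)%E.

Definition beta_integral (R : realType) (beta : R -> R) (a b : R)
    (h : R -> R) : \bar R :=
  (beta_integral0 beta h b - beta_integral0 beta h a)%E.

Definition beta_chebyshev (R : realType) (beta : R -> R) (a b : R)
    (f g : R -> R) : \bar R :=
  ((b - a)^-1%:E * beta_integral beta a b (fun x => (f x * g x)%R)
   - ((b - a)^-1%:E * beta_integral beta a b f)
     * ((b - a)^-1%:E * beta_integral beta a b g))%E.

Lemma beta_integral0_fin (R : realType) (beta h : R -> R) (x : R) :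
  cvgn (series (beta_term beta h x)) ->
  beta_integral0 beta h x = (limn (series (beta_term beta h x)))%:E.
Proof.
move=> cv; rewrite /beta_integral0 -EFin_lim//.
by congr (limn _); apply/funext => n /=; rewrite sumEFin.
Qed.

Lemma beta_integral_fin (R : realType) (beta : R -> R) (a b : R) (h : R -> R) :
  beta_integrable beta a b h ->
  beta_integral beta a b h =
  (limn (series (beta_term beta h b)) - limn (series (beta_term beta h a)))%:E.
Proof.
by move=> [cva cvb]; rewrite /beta_integral !beta_integral0_fin// EFinB.
Qed.

Lemma beta_chebyshev_fin (R : realType) (beta : R -> R) (a b : R)
    (f g : R -> R) :
  let J h := limn (series (beta_term beta h b))
             - limn (series (beta_term beta h a)) in
  beta_integrable beta a b f -> beta_integrable beta a b g ->
  beta_integrable beta a b (fun x => f x * g x) ->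
  beta_chebyshev beta a b f g =
  (1 / (b - a) * J (fun x => f x * g x)
   - (1 / (b - a) * J f) * (1 / (b - a) * J g))%:E.
Proof.
move=> J fi gi fgi; rewrite /beta_chebyshev !beta_integral_fin//.
by rewrite !div1r -!EFinM -EFinB.
Qed.

(* Main.v *)
(** All weights [beta^k b - beta^(k+1) b] are nonnegative, all weights
    [beta^k a - beta^(k+1) a] are nonpositive, and by telescoping their partial
    sums at [b] and [a] differ by at most [b - a].  Hence the
    Cauchy-Schwarz inequality gives
    [(partial sum of f)^2 <= (b - a) * (partial sum of f^2)].  The partial sums
    of [f^2] are bounded by the possibly infinite integral of [f^2], and those of
    [f] converge. *)
Require Import Defs.
From HB Require Import structures.
From mathcomp Require Import all_boot all_order all_algebra.
From mathcomp Require Import all_classical all_reals all_analysis.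
From mathcomp Require Import ring lra.
Import Order.TTheory GRing.Theory Num.Theory.
Import numFieldNormedType.Exports.
Local Open Scope classical_set_scope.
Local Open Scope ring_scope.

Lemma npeseries_lim_le (R : realType) (u : (\bar R)^nat) (n : nat) :
  (forall k, (u k <= 0)%E) ->
  (\sum_(0 <= k <oo) u k <= \sum_(0 <= k < n) u k)%E.
Proof.
move=> u0; apply: lime_le; first by apply: is_cvg_npeseries => k _ _.
by near=> m; apply: lee_sum_npos_natr => //; near: m; exact: nbhs_infty_ge.
Unshelve. all: by end_near. Qed.

(** Used with [c] equal to 1 or -1, the constant sign of the weights along an orbit: absolute
    convergence of [v] is then convergence of [u]. *)
Lemma cvgn_series_of_norm (R : realType) (c : R) (u v : R^nat) :
  (forall k, `|v k| = c * u k) -> cvgn (series u) -> cvgn (series v).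
Proof.
move=> vu cu; apply: normed_cvg.
have -> : [normed series v] = (fun n => c * series u n).
  by apply/funext => n; rewrite /series /= mulr_sumr; apply: eq_bigr.
by apply: is_cvgM => //; exact: is_cvg_cst.
Qed.

Section orbit.
Variables (R : realType) (I : interval R) (beta : R -> R) (s0 : R).
Hypothesis hbeta : is_beta I beta s0.

Lemma iter_beta_in (x : R) (k : nat) : x \in I -> iter k beta x \in I.
Proof. by move=> xI; elim: k => //= k /(beta_maps hbeta). Qed.

Lemma beta_le (x y : R) : x \in I -> y \in I -> x <= y -> beta x <= beta y.
Proof.
move=> xI yI; rewrite le_eqVlt => /orP[/eqP->//|xy].
exact/ltW/(beta_incr hbeta).
Qed.

(** Monotonicity and [beta s0 = s0] keep the orbit above [s0]; the sign condition [beta_attr] makes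
    it decrease. *)
Lemma iter_beta_ge (x : R) (k : nat) :
  x \in I -> s0 <= x -> s0 <= iter k.+1 beta x <= iter k beta x.
Proof.
move=> xI s0x.
have step y : y \in I -> s0 <= y -> s0 <= beta y <= y.
  move=> yI s0y; have := beta_le _ _ (beta_s0_in hbeta) yI s0y.
  rewrite (beta_s0_fix hbeta) => -> /=.
  move: s0y; rewrite le_eqVlt => /orP[/eqP<-|s0y].
    by rewrite (beta_s0_fix hbeta).
  by have := beta_attr hbeta yI; rewrite pmulr_rle0 ?subr_gt0// subr_le0.
have ge0 : s0 <= iter k beta x.
  by elim: k => //= k ih; have /andP[] := step _ (iter_beta_in _ k xI) ih.
exact: step (iter_beta_in _ k xI) ge0.
Qed.

Lemma iter_beta_le (x : R) (k : nat) :
  x \in I -> x <= s0 -> iter k beta x <= iter k.+1 beta x <= s0.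
Proof.
move=> xI xs0.
have step y : y \in I -> y <= s0 -> y <= beta y <= s0.
  move=> yI ys0; have := beta_le _ _ yI (beta_s0_in hbeta) ys0.
  rewrite (beta_s0_fix hbeta) => ->; rewrite andbT.
  move: ys0; rewrite le_eqVlt => /orP[/eqP->|ys0].
    by rewrite (beta_s0_fix hbeta).
  by have := beta_attr hbeta yI; rewrite nmulr_rle0 ?subr_lt0// subr_ge0.
have le0 : iter k beta x <= s0.
  by elim: k => //= k ih; have /andP[] := step _ (iter_beta_in _ k xI) ih.
exact: step (iter_beta_in _ k xI) le0.
Qed.

Lemma beta_term_ge0 (h : R -> R) (x : R) (k : nat) :
  x \in I -> s0 <= x -> (forall y, 0 <= h y) -> 0 <= beta_term beta h x k.
Proof.
move=> xI s0x h0; have /andP[_ le] := iter_beta_ge _ k xI s0x.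
by rewrite mulr_ge0// subr_ge0.
Qed.

Lemma beta_term_le0 (h : R -> R) (x : R) (k : nat) :
  x \in I -> x <= s0 -> (forall y, 0 <= h y) -> beta_term beta h x k <= 0.
Proof.
move=> xI xs0 h0; have /andP[le _] := iter_beta_le _ k xI xs0.
by rewrite mulr_le0_ge0// subr_le0.
Qed.

(** The weights are nonpositive at [a] and nonnegative at [b], so each term of [f] has, up to that
    sign, the term of [|f|] as absolute value. *)
Lemma abs_beta_integrable_integrable (a b : R) (f : R -> R) :
  a \in I -> b \in I -> a <= s0 <= b ->
  abs_beta_integrable beta a b f -> beta_integrable beta a b f.
Proof.
move=> aI bI /andP[as0 s0b] [ca cb]; split.
  apply: (cvgn_series_of_norm _ (-1) _ _ _ ca) => k.
  have /andP[le _] := iter_beta_le _ k aI as0.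
  by rewrite /beta_term normrM ler0_norm ?subr_le0// mulN1r mulNr.
apply: (cvgn_series_of_norm _ 1 _ _ _ cb) => k.
have /andP[_ le] := iter_beta_ge _ k bI s0b.
by rewrite /beta_term normrM ger0_norm ?subr_ge0// mul1r.
Qed.

End orbit.

(** Expand the square; the weights multiplying [t ^+ 2] telescope. *)
Lemma series_beta_sqrB (R : realType) (beta f : R -> R) (x t : R) (n : nat) :
  series (beta_term beta (fun y => (f y - t) ^+ 2) x) n =
  series (beta_term beta (fun y => f y * f y) x) n
  - 2 * t * series (beta_term beta f x) n + t ^+ 2 * (x - iter n beta x).
Proof.
rewrite /series /=; elim: n => [|n ih]; first by rewrite !big_geq//=; ring.
by rewrite !big_nat_recr//= ih /beta_term /=; ring.
Qed.

Lemma beta_cauchy_schwarz (R : realType) (I : interval R) (beta : R -> R)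
    (s0 a b : R) (f : R -> R) (n : nat) :
  is_beta I beta s0 -> a \in I -> b \in I -> a < b -> a <= s0 <= b ->
  (series (beta_term beta f b) n - series (beta_term beta f a) n) ^+ 2 <=
  (b - a) * (series (beta_term beta (fun x => f x * f x) b) n
             - series (beta_term beta (fun x => f x * f x) a) n).
Proof.
move=> hbeta aI bI ab /andP[as0 s0b].
set A := _ - series (beta_term beta f a) n.
set B := _ - series (beta_term beta (fun x => f x * f x) a) n.
have L0 : 0 < b - a by rewrite subr_gt0.
(* This [t] minimizes the quadratic [B - 2 * t * A + t ^+ 2 * (b - a)]. *)
pose t := A / (b - a).
have sb : 0 <= series (beta_term beta (fun y => (f y - t) ^+ 2) b) n.
  apply: sumr_ge0 => k _; apply: (beta_term_ge0 _ _ _ _ hbeta) => // y.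
  exact: sqr_ge0.
have sa : series (beta_term beta (fun y => (f y - t) ^+ 2) a) n <= 0.
  apply: sumr_le0 => k _; apply: (beta_term_le0 _ _ _ _ hbeta) => // y.
  exact: sqr_ge0.
(* The two orbits stay on opposite sides of [s0], so the total weight, [b - a] minus the gap between
   the iterates, is at most [b - a]. *)
have orb : iter n beta a <= iter n beta b.
  have /andP[le1 le2] := iter_beta_le _ _ _ _ hbeta _ n aI as0.
  have /andP[le3 le4] := iter_beta_ge _ _ _ _ hbeta _ n bI s0b.
  exact: le_trans (le_trans le1 le2) (le_trans le3 le4).
move: sb sa; rewrite !series_beta_sqrB => sb sa.
have quad : 0 <= B - 2 * t * A + t ^+ 2 * (b - a).
  have : 0 <= t ^+ 2 * (iter n beta b - iter n beta a).
    by rewrite mulr_ge0 ?sqr_ge0// subr_ge0.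
  rewrite /A /B; move: sb sa; lra.
have -> : A ^+ 2 = (b - a) * (2 * t * A - t ^+ 2 * (b - a)).
  by rewrite /t; field; rewrite gt_eqF.
by rewrite ler_pM2l//; lra.
Qed.

(** For [h >= 0] the partial sums increase at [b] and decrease at [a], so their difference stays
    below its limit, finite or not. *)
Lemma beta_integral_ge_series (R : realType) (I : interval R) (beta : R -> R)
    (s0 a b : R) (h : R -> R) (n : nat) :
  is_beta I beta s0 -> a \in I -> b \in I -> a <= s0 <= b ->
  (forall x, 0 <= h x) ->
  ((series (beta_term beta h b) n - series (beta_term beta h a) n)%:E
   <= beta_integral beta a b h)%E.
Proof.
move=> hbeta aI bI /andP[as0 s0b] h0.
have leb : ((series (beta_term beta h b) n)%:E <= beta_integral0 beta h b)%E.
  rewrite /series /= -sumEFin; apply: nneseries_lim_ge => k _ _.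
  by rewrite lee_fin (beta_term_ge0 _ _ _ _ hbeta).
have gea : (beta_integral0 beta h a <= (series (beta_term beta h a) n)%:E)%E.
  rewrite /series /= -sumEFin; apply: npeseries_lim_le => k.
  by rewrite lee_fin (beta_term_le0 _ _ _ _ hbeta).
exact: leeB leb gea.
Qed.

Theorem proposition3p3 (R : realType) (I : interval R) (beta : R -> R)
    (s0 a b : R) (hbeta : is_beta I beta s0) (ha : a \in I) (hb : b \in I)
    (hab : a < b) (f : R -> R) (hf : abs_beta_integrable beta a b f)
    (hs0 : a <= s0 <= b) :
  (0 <= beta_chebyshev beta a b f f)%E.
Proof.
have fi := abs_beta_integrable_integrable _ _ _ _ hbeta _ _ _ ha hb hs0 hf.
have L0 : 0 < b - a by rewrite subr_gt0.
rewrite /beta_chebyshev (beta_integral_fin fi).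
have sq n := beta_integral_ge_series _ _ _ _ _ _ (fun x => f x * f x) n
  hbeta ha hb hs0 (fun x => sqr_ge0 (f x)).
(* Case split on the integral of [f ^+ 2]: a real [q], [+oo] or [-oo]. *)
case: (beta_integral _ _ _ _) sq => [q| |] sq.
- set J := limn _ - limn _.
  have cJ : (fun n => (series (beta_term beta f b) n
                       - series (beta_term beta f a) n) ^+ 2) @ \oo --> J ^+ 2.
    by case: fi => ca cb; rewrite expr2; apply: cvgM; apply: cvgB.
  have Jq : J ^+ 2 <= (b - a) * q.
    apply: (cvgr_to_le cJ); apply: nearW => n.
    apply: le_trans (beta_cauchy_schwarz _ _ _ _ _ _ f n hbeta ha hb hab hs0) _.
    by rewrite ler_pM2l// -lee_fin.
  rewrite -!EFinM -EFinB lee_fin.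
  have -> : (b - a)^-1 * q - (b - a)^-1 * J * ((b - a)^-1 * J) =
      ((b - a) * q - J ^+ 2) / (b - a) ^+ 2.
    by field; rewrite gt_eqF.
  by rewrite divr_ge0 ?sqr_ge0// subr_ge0.
(* The subtracted square is finite, so the functional is [+oo]. *)
- by rewrite mulry gtr0_sg ?invr_gt0// mul1e -!EFinM addye// leey.
(* Any partial sum is a real lower bound, which excludes [-oo]. *)
- by have := sq 0%N; rewrite leeNy_eq.
Qed.
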